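(* Let the standing assumptions (i)–(v) and the solvability assumption of the context hold. If $\psi=\|\cdot\|^2/2$ and $\Omega=\mathbb R^n$, then, for every $\lambda>0$, $x\in\operatorname{dom}\rho$ and $y\in T_\lambda(x)$, $$\left\|\frac{x-y}{\lambda}\right\|^2\le\mathcal R_\lambda(x).$$ If also $\rho=0$, then $\mathcal R_\lambda(x)=\|\nabla f(x)\|^2$. Thus, in this smooth unconstrained case, if GA-BPGnc (described in the context) has not returned a stationary point in its first $N\ge2$ iterations, then with $\mathcal A_N=\{1\le k\le N:\delta_k>0\}$, $\tau_k=2\delta_k/(\lambda_k\|\nabla f(x_k)\|^2)$ and $\underline\lambda=\min\{\lambda_0,1/(\gamma_-L)\}$, $$\min_{k\in\mathcal A_N}\|\nabla f(x_k)\|^2\le\frac{2(\Phi(y_0)-\Phi^\star)}{\sum_{k\in\mathcal A_N}\tau_k\lambda_k}\le\frac{4(\Phi(y_0)-\Phi^\star)}{\sigma\underline\lambda(N-1)}.$$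
   Context: Notation. $\langle\cdot,\cdot\rangle$ and $\|\cdot\|$ are the Euclidean inner product and norm on $\mathbb R^n$. For $h:\mathbb R^n\to(-\infty,+\infty]$, $\operatorname{dom}h=\{h<+\infty\}$ and $h^*$ is the convex conjugate. A proper lower semicontinuous convex function is Legendre if it is essentially smooth and essentially strictly convex; then $\nabla h^*=(\nabla h)^{-1}$ on $\operatorname{int}\operatorname{dom}h^*$. For $v$ where $h$ is differentiable, $D_h(u,v)=h(u)-h(v)-\langle\nabla h(v),u-v\rangle$; the same notation is used for (possibly nonconvex) $f$. Standing assumptions. (i) $\psi:\mathbb R^n\to(-\infty,+\infty]$ is Legendre and $\Omega=\operatorname{int}\operatorname{dom}\psi$. (ii) $f:\mathbb R^n\to(-\infty,+\infty]$ is proper, lower semicontinuous, $\operatorname{dom}\psi\subset\operatorname{dom}f$, and $f$ is continuously differentiable on $\Omega$. (iii) $\rho:\mathbb R^n\to(-\infty,+\infty]$ is proper, lower semicontinuous, convex, with $\Omega\cap\operatorname{dom}\rho\ne\emptyset$. (iv) There is $L>0$ with $D_f(u,v)\le L D_\psi(u,v)$ for all $u,v\in\Omega$. (v) With $\Phi=f+\rho$, $\Phi^\star=\inf_{x\in\operatorname{cl}\Omega}\Phi(x)>-\infty$. BPG map. For $x\in\Omega$, $\lambda>0$, $$T_\lambda(x)=\operatorname{argmin}_{u\in\operatorname{cl}\Omega}\{\rho(u)+\langle\nabla f(x),u-x\rangle+\lambda^{-1}D_\psi(u,x)\}.$$ Solvability assumption: $T_\lambda(x)\neq\emptyset$ for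 every $x\in\Omega$, $\lambda>0$ (the minimizer is then unique and lies in $\Omega$). For $x\in\Omega\cap\operatorname{dom}\rho$ and $\widehat y\in T_\lambda(x)$ put $$\mathcal R_\lambda(x)=-\frac2\lambda\left(\langle\nabla f(x),\widehat y-x\rangle+\rho(\widehat y)-\rho(x)+\lambda^{-1}D_\psi(\widehat y,x)\right).$$ GA-BPGnc. Inputs: a Legendre function $\phi:\mathbb R^n\to(-\infty,+\infty]$; $y_0\in\Omega\cap\operatorname{dom}\rho$; $\lambda_{\max}\ge\lambda_0>0$; $\gamma_+\ge1$, $\gamma_->1$; $\sigma\in(0,1)$; a rule choosing weights $\beta_j\ge0$. Set $z_0=y_0$. For $k=1,2,\dots$: set $\lambda=\lambda_0$ if $k=1$ and $\lambda=\min\{\gamma_+\lambda_{k-1},\lambda_{\max}\}$ if $k\ge2$; choose $\beta_{k+1}\ge0$ from the available history; set $x_k=z_{k-1}$. Compute $\widehat y\in T_\lambda(x_k)$; if $\widehat y=x_k$ stop and return $x_k$ (a stationary point); if $D_f(\widehat y,x_k)>\lambda^{-1}D_\psi(\widehat y,x_k)$, replace $\lambda$ by $\lambda/\gamma_-$ and recompute $\widehat y$ (same $x_k$, same $\beta_{k+1}$). When the test passes, set $\lambda_k=\lambda$, $\widehat y_k=\widehat y$, $\delta_k=\Phi(y_{k-1})-\Phi(\widehat y_k)$; set $y_k=\widehat y_k$ if $\delta_k>0$ and $y_k=y_{k-1}$ otherwise. By default $z_k=y_k$. If $\delta_k\ge\frac{\sigma\lambda_k}2\mathcal R_{\lambda_k}(x_k)$,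 $y_k,y_{k-1}\in\operatorname{int}\operatorname{dom}\phi$, $p=\nabla\phi(y_k)+\beta_{k+1}[\nabla\phi(y_k)-\nabla\phi(y_{k-1})]\in\operatorname{int}\operatorname{dom}\phi^*$, and $\widehat z=\nabla\phi^*(p)\in\Omega\cap\operatorname{dom}\rho$, set instead $z_k=\widehat z$. *)

(* Defs.v *)
From mathcomp Require Import all_boot all_order all_algebra.
From mathcomp Require Import all_classical all_reals all_analysis.

Set Implicit Arguments.
Unset Strict Implicit.
Unset Printing Implicit Defensive.

Import Order.TTheory GRing.Theory Num.Theory numFieldNormedType.Exports.

Local Open Scope classical_set_scope.
Local Open Scope ring_scope.

(* The library norm on 'rV[R]_n is the sup norm. It induces the Euclidean
   topology, so interiors, closures, limits and differentiability below are the
   library's; only inner products and norms in formulas are the Euclidean ones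
   [dotp] and [enorm]. *)

Section ConvexAnalysis.
Context {R : realType} {n : nat}.
Local Notation E := 'rV[R]_n.
Implicit Types (h : E -> \bar R) (u v x y p : E).

Definition dotp u v : R := \sum_(i < n) u 0 i * v 0 i.

Definition enorm u : R := Num.sqrt (dotp u u).

Definition edom h : set E := [set x | (h x < +oo)%E].

Definition proper_fun h : Prop :=
  (forall x, h x != -oo%E) /\ edom h !=set0.

Definition convex_efun h : Prop :=
  forall x y (t : R), 0 < t < 1 ->
    (h (t *: x + (1 - t) *: y)%R <= t%:E * h x + (1 - t)%:E * h y)%E.

(* [fine \o h] agrees with [h] around any interior point of [edom h] when [h]
   never takes the value -oo; [egrad] and differentiability are only used at
   such points. *)
Definition egrad h x : E := \row_(i < n) 'D_(delta_mx 0 i) (fine \o h) x.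

Definition conjugate h p : \bar R :=
  ereal_sup [set ((dotp p x)%:E - h x)%E | x in [set: E]].

Definition subdiff h x : set E :=
  [set p | forall y, (h x + (dotp p (y - x)%R)%:E <= h y)%E].

Definition subdiff_dom h : set E := [set x | subdiff h x !=set0].

(* Rockafellar, Convex Analysis, Section 26. *)
Definition essentially_smooth h : Prop :=
  let C := interior (edom h) in
  [/\ C !=set0,
      (forall x, C x -> differentiable (fine \o h) x) &
      forall (s : nat -> E) (b : E), (forall i, C (s i)) ->
        (closure C `\` C) b -> s @ \oo --> b ->
        (fun i => enorm (egrad h (s i))) @ \oo --> +oo].

Definition essentially_strictly_convex h : Prop :=
  forall C : set (convex_lmodType E), convex_set C -> C `<=` subdiff_dom h ->
  forall x y (t : R), C x -> C y -> x != y -> 0 < t < 1 ->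
    (h (t *: x + (1 - t) *: y)%R < t%:E * h x + (1 - t)%:E * h y)%E.

Definition legendre h : Prop :=
  [/\ proper_fun h, lower_semicontinuous h, convex_efun h,
      essentially_smooth h & essentially_strictly_convex h].

Definition C1_on h (A : set E) : Prop :=
  forall x, A x ->
    differentiable (fine \o h) x /\ {for x, continuous (egrad h)}.

Definition bregman h u v : \bar R :=
  (h u - h v - (dotp (egrad h v) (u - v)%R)%:E)%E.

End ConvexAnalysis.

Section BPG.
Context {R : realType} {n : nat}.
Local Notation E := 'rV[R]_n.
Variables (f psi rho : E -> \bar R).

Definition Omega : set E := interior (edom psi).

Definition Phi (x : E) : \bar R := (f x + rho x)%E.

Definition Phi_star : \bar R := ereal_inf [set Phi x | x in closure Omega].

Definition bpg_obj (lam : R) (x u : E) : \bar R :=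
  (rho u + (dotp (egrad f x) (u - x)%R)%:E + (lam^-1)%:E * bregman psi u x)%E.

Definition bpg_map (lam : R) (x : E) : set E :=
  [set y | closure Omega y /\
     forall u, closure Omega u -> (bpg_obj lam x y <= bpg_obj lam x u)%E].

(* The residual R_lam(x), with the minimizer [y] in [bpg_map lam x] from which
   it is computed kept as an explicit argument. *)
Definition bpg_res (lam : R) (x y : E) : \bar R :=
  ((- (2 / lam))%:E *
   ((dotp (egrad f x) (y - x)%R)%:E + rho y - rho x +
    (lam^-1)%:E * bregman psi y x))%E.

Variables (phi : E -> \bar R) (lam0 lam_max gam_p gam_m sigma : R).

(* [backtrack x lam lam' yh]: the inner loop at the point [x], entered with
   step [lam], ends by accepting the step [lam'] and the point [yh]. No
   constructor applies to a trial point equal to [x], since the algorithm then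
   stops and returns [x]. *)
Inductive backtrack (x : E) : R -> R -> E -> Prop :=
| backtrack_accept lam yh :
    bpg_map lam x yh -> yh != x ->
    (bregman f yh x <= (lam^-1)%:E * bregman psi yh x)%E ->
    backtrack x lam lam yh
| backtrack_reduce lam yh lam' yh' :
    bpg_map lam x yh -> yh != x ->
    ((lam^-1)%:E * bregman psi yh x < bregman f yh x)%E ->
    backtrack x (lam / gam_m) lam' yh' ->
    backtrack x lam lam' yh'.

Definition step_init (lam : nat -> R) (k : nat) : R :=
  if k == 1%N then lam0 else Num.min (gam_p * lam k.-1) lam_max.

(* [delta y yh k] is finite along a run. *)
Definition delta (y yh : nat -> E) (k : nat) : \bar R :=
  (Phi (y k.-1) - Phi (yh k))%E.

Definition extrap_dual (b : R) (y' y : E) : E :=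
  egrad phi y + b *: (egrad phi y - egrad phi y').

Definition extrap_cond (b lam : R) (x yh y' y : E) : Prop :=
  let p := extrap_dual b y' y in
  [/\ ((sigma * lam / 2)%:E * bpg_res lam x yh <= Phi y' - Phi yh)%E,
      interior (edom phi) y /\ interior (edom phi) y',
      interior (edom (conjugate phi)) p &
      (Omega `&` edom rho) (egrad (conjugate phi) p)].

(* N completed iterations of GA-BPGnc started at [y0], none of which returned a
   stationary point. Whatever rule selects the weights from the history, a run
   only depends on the resulting values [beta]. *)
Record ga_bpgnc_run (beta : nat -> R) (y0 : E) (N : nat)
    (x y z yh : nat -> E) (lam : nat -> R) : Prop := {
  run_y0 : y 0%N = y0;
  run_z0 : z 0%N = y0;
  run_x : forall k, (1 <= k <= N)%N -> x k = z k.-1;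
  run_step : forall k, (1 <= k <= N)%N ->
    backtrack (x k) (step_init lam k) (lam k) (yh k);
  run_y : forall k, (1 <= k <= N)%N ->
    y k = if (0 < delta y yh k)%E then yh k else y k.-1;
  run_z : forall k, (1 <= k <= N)%N ->
    z k = if `[< extrap_cond (beta k.+1) (lam k) (x k) (yh k)
                   (y k.-1) (y k) >]
          then egrad (conjugate phi) (extrap_dual (beta k.+1) (y k.-1) (y k))
          else y k
}.

End BPG.

(* Main.v *)
Require Import Defs.
From mathcomp Require Import all_boot all_order all_algebra.
From mathcomp Require Import all_classical all_reals all_analysis.
From mathcomp Require Import ring lra.
Set Implicit Arguments.
Unset Strict Implicit.
Unset Printing Implicit Defensive.
Import Order.TTheory GRing.Theory Num.Theory numFieldNormedType.Exports.
Local Open Scope classical_set_scope.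
Local Open Scope ring_scope.

(** With the kernel [psi = |.|^2/2] the Bregman distance is half the squared
    Euclidean distance, so the subproblem defining [bpg_map] is a proximal
    gradient step.

    For convex [rho] its objective is strongly convex: comparing the minimizer
    [y] with points of the segment from [y] to [x] gains an extra quadratic
    term, which is exactly the lower bound on the residual
    ([bpg_res_half_sqnorm_ge]).

    For [rho = 0] the step is [y = x - lam * grad f x]
    ([bpg_map_gradient_step]), whence the residual is [|grad f x|^2].

    The rate follows from three facts. Backtracking never goes below [lam_low],
    because a rejected step is larger than [1 / L] by the descent hypothesis
    ([backtrack_accepted]). Among two consecutive iterations one decreases the
    objective by at least [sigma * lam / 2 * |grad f|^2]: if iteration [k] does
    not extrapolate, then iteration [k + 1] starts at the current best point and
    the accepted gradient step decreases the objective from there; if it does,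
    the decrease at iteration [k] was the condition for extrapolating
    ([weight_pair]). Hence each of the [N - 1] consecutive pairs contributes at
    least [sigma * lam_low] to the weights [tau k * lam k]; as an iteration
    lies in at most two pairs, the sum of the weights is at least
    [sigma * lam_low * (N - 1) / 2] ([sum_ge_of_pairs]). Finally the same
    weights applied to the squared gradient norms give twice the decreases
    [d k], which telescope to at most twice the initial gap
    ([decrease_telescope]); a weighted mean dominates the minimum
    ([ratio_bounds]). *)

(** * Euclidean geometry *)

Section EuclideanGeometry.
Context {R : realType} {n : nat}.
Implicit Types (a t : R) (u v w g : 'rV[R]_n).

Lemma dotpC u v : dotp u v = dotp v u.
Proof. by apply: eq_bigr => i _; rewrite mulrC. Qed.

Lemma dotpDl u v w : dotp (u + v) w = dotp u w + dotp v w.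
Proof. by rewrite /dotp -big_split; apply: eq_bigr => i _; rewrite mxE mulrDl. Qed.

Lemma dotpZl a u v : dotp (a *: u) v = a * dotp u v.
Proof. by rewrite /dotp mulr_sumr; apply: eq_bigr => i _; rewrite mxE mulrA. Qed.

Lemma dotpDr u v w : dotp u (v + w) = dotp u v + dotp u w.
Proof. by rewrite dotpC dotpDl ![dotp _ u]dotpC. Qed.

Lemma dotpZr a u v : dotp u (a *: v) = a * dotp u v.
Proof. by rewrite dotpC dotpZl dotpC. Qed.

Lemma dotpNl u v : dotp (- u) v = - dotp u v.
Proof. by rewrite -scaleN1r dotpZl mulN1r. Qed.

Lemma dotpNr u v : dotp u (- v) = - dotp u v.
Proof. by rewrite dotpC dotpNl dotpC. Qed.

Lemma dotpp_ge0 u : 0 <= dotp u u.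
Proof. by apply: sumr_ge0 => i _; rewrite -expr2 sqr_ge0. Qed.

Lemma dotpp_eq0 u : dotp u u = 0 -> u = 0.
Proof.
move=> /eqP; rewrite psumr_eq0 => [|i _]; last by rewrite -expr2 sqr_ge0.
move=> /allP u0; apply/rowP => i; apply/eqP; rewrite mxE -[_ == 0]sqrf_eq0 expr2.
by apply: u0; rewrite mem_index_enum.
Qed.

Lemma enorm_sqr u : enorm u ^+ 2 = dotp u u.
Proof. by rewrite sqr_sqrtr// dotpp_ge0. Qed.

Lemma enormZ_sqr a u : enorm (a *: u) ^+ 2 = a ^+ 2 * enorm u ^+ 2.
Proof. by rewrite !enorm_sqr dotpZl dotpZr expr2 mulrA. Qed.

Lemma dotp_delta u (i : 'I_n) : dotp u (delta_mx 0 i) = u 0 i.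
Proof.
rewrite /dotp (bigD1 i)//= mxE !eqxx mulr1 big1 ?addr0// => j ji.
by rewrite mxE (negbTE ji) mulr0.
Qed.

Definition half_sqnorm u : \bar R := (enorm u ^+ 2 / 2)%:E.

(** Along the [i]-th coordinate the difference quotient is the affine function
    [h |-> u_i + h / 2]. *)
Lemma egrad_half_sqnorm u : egrad half_sqnorm u = u.
Proof.
apply/rowP => i; rewrite mxE /derive; set q := (X in X @ _).
have qE : {near 0^', (fun h : R => u 0 i + h / 2) =1 q}.
  near=> h; rewrite /q /= !enorm_sqr !dotpDl !dotpDr !dotpZl !dotpZr.
  rewrite [dotp (delta_mx 0 i) u]dotpC !dotp_delta mxE !eqxx /=.
  rewrite /GRing.scale /=.
  have h0 : h != 0 by near: h; exact: nbhs_dnbhs_neq.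
  by field.
apply: cvg_lim => //; apply: (cvg_trans (near_eq_cvg qE)).
apply: cvg_within_filter.
have lim0 : u 0 i + h / 2 @[h --> 0] --> u 0 i + 0 / 2.
  by apply: cvgD; [exact: cvg_cst | apply: cvgMr_tmp; exact: cvg_id].
by rewrite mul0r addr0 in lim0.
Unshelve. all: by end_near.
Qed.

Lemma bregman_half_sqnorm u v :
  bregman half_sqnorm u v = (enorm (u - v) ^+ 2 / 2)%:E.
Proof.
rewrite /bregman egrad_half_sqnorm /half_sqnorm -!EFinB; congr (_%:E).
by rewrite !enorm_sqr !(dotpDl, dotpDr, dotpNl, dotpNr) (dotpC u v); lra.
Qed.

End EuclideanGeometry.

(** * The quadratic kernel *)

Section QuadraticKernel.
Context {R : realType} {n : nat}.
Implicit Types (lam : R) (x y u : 'rV[R]_n) (f rho : 'rV[R]_n -> \bar R).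

Lemma Omega_half_sqnorm : Omega (@half_sqnorm R n) = [set: 'rV[R]_n].
Proof.
rewrite /Omega (_ : edom _ = setT) ?interiorT//.
by apply/seteqP; split => // u _; rewrite /edom /= ltry.
Qed.

Lemma bpg_map_half_sqnorm f rho lam x y :
  bpg_map f half_sqnorm rho lam x y <->
  forall u, (bpg_obj f half_sqnorm rho lam x y
             <= bpg_obj f half_sqnorm rho lam x u)%E.
Proof.
rewrite /bpg_map Omega_half_sqnorm closureT.
by split => [[_ ymin] u|ymin]; [exact: ymin | split => // u _; exact: ymin].
Qed.

Lemma bpg_obj_half_sqnorm f rho lam x u :
  bpg_obj f half_sqnorm rho lam x u =
  (rho u + (dotp (egrad f x) (u - x) + lam^-1 * (enorm (u - x) ^+ 2 / 2))%:E)%E.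
Proof. by rewrite /bpg_obj bregman_half_sqnorm -EFinM EFinD addeA. Qed.

(** Divide by [t] and let [t] tend to [0]: the first-order form of a comparison
    along a segment, where [2 * t - t ^+ 2 = 1 - (1 - t) ^+ 2] is the variation
    of the squared distance to the end point [t = 1]. *)
Lemma le_of_segment (a b c : R) :
  (forall t, 0 < t < 1 -> t * a + (2 * t - t ^+ 2) * b <= t * c) ->
  a + 2 * b <= c.
Proof.
move=> seg; rewrite leNgt; apply/negP => lt_c.
(* For [t] with [t * |b|] smaller than the excess [e], the hypothesis at [t]
   contradicts [e > 0]. *)
have e0 : 0 < a + 2 * b - c by lra.
have b0 : 0 <= `|b| by [].
set e := a + 2 * b - c in e0.
pose t := e / (2 * (e + `|b|)).
have t01 : 0 < t < 1.
  by rewrite divr_gt0 ?ltr_pdivrMr //=; lra.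
have /andP[t0 _] := t01.
have := seg t t01.
have tE : t * (2 * (e + `|b|)) = e by rewrite divfK//; lra.
have : t * b <= t * `|b| by rewrite ler_wpM2l ?ler_norm// ltW.
have : 0 < t * e by exact: mulr_gt0.
move=> te0 tb le1.
have {le1} : t * (a + 2 * b - t * b) <= t * c by nra.
rewrite ler_pM2l// => le1.
by rewrite /e in te0 tE; nra.
Qed.

(** The optimality of [y] against [t x + (1 - t) y], with [rho] convex and the
    linear and quadratic terms explicit, gives as [t] tends to [0]
    [<g, y - x> + rho y - rho x + |y - x|^2 / lam <= 0], where [g] is the
    gradient of [f] at [x]. The residual contains only half of the quadratic
    term, and the other half is the claimed bound. *)
Lemma bpg_res_half_sqnorm_ge f rho lam x y :
  (forall u, rho u != -oo%E) -> convex_efun rho -> 0 < lam -> edom rho x ->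
  bpg_map f half_sqnorm rho lam x y ->
  ((enorm (lam^-1 *: (x - y)) ^+ 2)%:E <= bpg_res f half_sqnorm rho lam x y)%E.
Proof.
move=> rho_ninf rho_cvx lam0 /= rhox /bpg_map_half_sqnorm ymin.
have {rhox} [r rxE] : exists r, rho x = r%:E.
  by move: (rho_ninf x) rhox; rewrite /edom /=; case: (rho x) => // r; exists r.
have [s ryE] : exists s, rho y = s%:E.
  move: (rho_ninf y) (ymin x); rewrite !bpg_obj_half_sqnorm rxE.
  by case: (rho y) => // s; exists s.
set g := egrad f x in ymin *; set D := y - x in ymin *.
have seg : dotp g D + s - r + 2 * (lam^-1 * (enorm D ^+ 2 / 2)) <= 0.
  apply: le_of_segment => t t01.
  have := ymin (t *: x + (1 - t) *: y).
  rewrite !bpg_obj_half_sqnorm ryE -/g -/D.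
  have -> : t *: x + (1 - t) *: y - x = (1 - t) *: D.
    by apply/rowP => i; rewrite !mxE; ring.
  rewrite enormZ_sqr dotpZr => le1.
  have := le_trans le1 (leeD2r _ (rho_cvx x y t t01)).
  rewrite rxE ryE -!EFinM -!EFinD lee_fin.
  set q := _^-1 * _; have -> : lam^-1 * ((1 - t) ^+ 2 * enorm D ^+ 2 / 2) =
    (1 - t) ^+ 2 * q by rewrite /q; ring.
  by nra.
rewrite /bpg_res bregman_half_sqnorm rxE ryE -/g -/D -EFinM.
rewrite lee_fin enormZ_sqr -opprB -/D -scaleN1r enormZ_sqr sqrrN expr1n mul1r.
set q := enorm D ^+ 2 in seg *.
have l0 : 0 < lam^-1 by rewrite invr_gt0.
by nra.
Qed.

(** Completing the square, the objective at [y] exceeds its value at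
    [x - lam g] by [|y - x + lam g|^2 / (2 lam)]. *)
Lemma bpg_map_gradient_step f lam x y : 0 < lam ->
  bpg_map f half_sqnorm (fun=> 0%E) lam x y -> y = x - lam *: egrad f x.
Proof.
move=> lam0 /bpg_map_half_sqnorm /(_ (x - lam *: egrad f x)).
rewrite !bpg_obj_half_sqnorm !add0e lee_fin.
set g := egrad f x; have -> : x - lam *: g - x = - lam *: g.
  by rewrite addrAC subrr sub0r scaleNr.
move DE : (y - x) => D le1.
have : dotp (D + lam *: g) (D + lam *: g) <= 0.
  move: le1; rewrite enormZ_sqr !enorm_sqr !(dotpDl, dotpDr, dotpZl, dotpZr).
  rewrite (dotpC D g) sqrrN -(ler_pM2l lam0).
  (* Both sides were multiplied by [lam] to clear the denominators. *)
  rewrite [X in X <= _ -> _](_ : _ = lam * dotp g D + dotp D D / 2); last by field; rewrite gt_eqF.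
  rewrite [X in _ <= X -> _](_ : _ = - (lam ^+ 2 * dotp g g / 2)); last by field; rewrite gt_eqF.
  by nra.
move=> le0; have /dotpp_eq0 : dotp (D + lam *: g) (D + lam *: g) = 0.
  by apply/eqP; rewrite eq_le le0 dotpp_ge0.
by move/eqP; rewrite addr_eq0 -DE subr_eq => /eqP ->; rewrite addrC.
Qed.

Lemma bpg_res_smooth f lam x y : 0 < lam ->
  bpg_map f half_sqnorm (fun=> 0%E) lam x y ->
  bpg_res f half_sqnorm (fun=> 0%E) lam x y = (enorm (egrad f x) ^+ 2)%:E.
Proof.
move=> lam0 /(bpg_map_gradient_step lam0) yE.
rewrite /bpg_res bregman_half_sqnorm sube0 adde0 -EFinM.
congr (_%:E); have -> : y - x = - lam *: egrad f x.
  by rewrite yE addrAC subrr sub0r scaleNr.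
by rewrite enormZ_sqr dotpZr -enorm_sqr; field; rewrite gt_eqF.
Qed.

End QuadraticKernel.


(** * Elementary sums *)

(** Summing the hypothesis over the [N - 1] consecutive pairs counts each term
    at most twice. *)
Lemma sum_ge_of_pairs (R : realFieldType) (t : nat -> R) (c : R) (N : nat) :
  (forall k, (1 <= k <= N)%N -> 0 <= t k) ->
  (forall k, (1 <= k < N)%N -> c <= t k + t k.+1) ->
  (1 <= N)%N -> c * (N%:R - 1) <= 2 * \sum_(1 <= k < N.+1) t k.
Proof.
move=> t0 pair N1.
(* In the sum over pairs the two extreme terms are counted only once. *)
suff : c * (N%:R - 1) + t 1%N + t N <= 2 * \sum_(1 <= k < N.+1) t k.
  have := t0 1%N; have := t0 N; rewrite N1 leqnn => /(_ isT) ? /(_ isT) ?.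
  by lra.
elim: N N1 pair {t0} => // -[_ _ _|N IH _ pair].
  by rewrite big_nat1; lra.
rewrite big_nat_recr//= mulrDr.
have := pair N.+1; rewrite ltnSn => /(_ isT) pairN.
have pairs k : (1 <= k < N.+1)%N -> c <= t k + t k.+1.
  by move=> /andP[k1 kN]; apply: pair; rewrite k1 ltnW.
have := IH isT pairs; rewrite -[N.+2%:R]natr1.
by lra.
Qed.

(** If every [g k] exceeded [G / \sum w], then the [w]-weighted sum of the [g k]
    would exceed [G]; the strictness uses that some weight is nonzero, which
    also makes [A] nonempty. *)
Lemma ratio_bounds (R : realType) (A : seq nat) (g w : nat -> R) (G S0 : R) :
  (forall k, k \in A -> 0 <= w k) ->
  0 < S0 -> S0 <= \sum_(k <- A) w k ->
  \sum_(k <- A) w k * g k <= G -> 0 <= G ->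
  (\big[Order.min/+oo%E]_(k <- A) (g k)%:E <= (G / \sum_(k <- A) w k)%:E)%E /\
  G / \sum_(k <- A) w k <= G / S0.
Proof.
move=> w0 S00 leS leG G0; have SA0 := lt_le_trans S00 leS.
split; last by rewrite ler_wpM2l// lef_pV2 ?posrE.
rewrite leNgt; apply/negP => lt_min.
set q := G / _ in lt_min.
have gtq k : k \in A -> q < g k.
  move=> kA; rewrite -lte_fin; apply: (lt_le_trans lt_min).
  exact: ge_bigmin_seq.
suff : \sum_(k <- A) w k * q < \sum_(k <- A) w k * g k.
  by rewrite -mulr_suml mulrC divfK ?gt_eqF// ltNge leG.
rewrite lt_neqAle; apply/andP; split; last first.
  rewrite big_seq [leRHS]big_seq ler_sum// => k kA.
  by rewrite ler_wpM2l ?w0// ltW ?gtq.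
apply/negP => /eqP eqS.
have /eqP := eqS; rewrite eq_sym -subr_eq0 -sumrB big_seq psumr_eq0; last first.
  by move=> k kA; rewrite -mulrBr mulr_ge0 ?w0// subr_ge0 ltW ?gtq.
move=> /allP all0; move: SA0; rewrite big_seq big1 ?ltxx// => k kA.
have := all0 k kA; rewrite kA /= -mulrBr mulf_eq0 subr_eq0 (gt_eqF (gtq k kA)) orbF.
by move/eqP.
Qed.

(** * Runs of the algorithm in the smooth unconstrained case *)

Section SmoothRun.
Context {R : realType} {n : nat}.
Variable F : 'rV[R]_n -> R.
Let f : 'rV[R]_n -> \bar R := fun x => (F x)%:E.
Let rho : 'rV[R]_n -> \bar R := fun=> 0%E.
Implicit Types (lam c : R) (x y u : 'rV[R]_n).

Lemma egrad_sqnorm_gt0 lam x y : 0 < lam -> bpg_map f half_sqnorm rho lam x y ->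
  y != x -> 0 < enorm (egrad f x) ^+ 2.
Proof.
move=> lam0 /(bpg_map_gradient_step lam0) ->; apply: contra_neqT.
rewrite -leNgt enorm_sqr => le0.
have /dotpp_eq0 -> : dotp (egrad f x) (egrad f x) = 0.
  by apply/eqP; rewrite eq_le le0 dotpp_ge0.
by rewrite scaler0 subr0.
Qed.

(** The acceptance test bounds [f] at [y] by its quadratic model, whose value at
    the gradient step is [F x - lam / 2 * |grad f x|^2]. *)
Lemma accepted_step_decrease lam x y : 0 < lam ->
  bpg_map f half_sqnorm rho lam x y ->
  (bregman f y x <= (lam^-1)%:E * bregman half_sqnorm y x)%E ->
  lam / 2 * enorm (egrad f x) ^+ 2 <= F x - F y.
Proof.
move=> lam0 /(bpg_map_gradient_step lam0) yE.
rewrite bregman_half_sqnorm /bregman /f -/f -!EFinB -EFinM lee_fin.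
have -> : y - x = - lam *: egrad f x.
  by rewrite yE addrAC subrr sub0r scaleNr.
rewrite enormZ_sqr dotpZr -enorm_sqr sqrrN.
set q := enorm _ ^+ 2.
have -> : lam^-1 * (lam ^+ 2 * q / 2) = lam / 2 * q by field; rewrite gt_eqF.
by lra.
Qed.

(** A rejected step satisfies [1 / lam < L], so dividing it by [gam_m] keeps it
    above [1 / (gam_m * L)]; the lower bound [c] is thus invariant. *)
Lemma backtrack_accepted gam_m L c x lam lam' yh :
  (forall u v, (bregman f u v <= L%:E * bregman half_sqnorm u v)%E) ->
  1 < gam_m -> 0 < L -> 0 < c -> c <= 1 / (gam_m * L) -> c <= lam ->
  backtrack f half_sqnorm rho gam_m x lam lam' yh ->
  [/\ c <= lam', bpg_map f half_sqnorm rho lam' x yh, yh != x &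
      (bregman f yh x <= (lam'^-1)%:E * bregman half_sqnorm yh x)%E].
Proof.
move=> descent gam1 L0 c0 cL c_lam bt.
elim: bt c_lam => {lam lam' yh} [lam yh ymap yx acc|lam yh lam' yh' ymap yx rej _ IH] c_lam.
  by split.
apply: IH; have lam0 : 0 < lam := lt_le_trans c0 c_lam.
have := lt_le_trans rej (descent yh x).
rewrite bregman_half_sqnorm -!EFinM lte_fin => lt1.
have lamL : lam^-1 < L.
  rewrite ltNge; apply/negP => le1.
  move: lt1; rewrite ltNge; apply/negP/negPn.
  by rewrite ler_wpM2r// divr_ge0// sqr_ge0.
apply: (le_trans cL); have g0 : 0 < gam_m by lra.
rewrite ler_pdivlMr// div1r invfM mulrAC mulVf ?gt_eqF// mul1r.
by rewrite -(invrK lam) lef_pV2 ?posrE ?invr_gt0// ltW.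
Qed.


Section Run.
Variables (phi : 'rV[R]_n -> \bar R) (L lam0 lam_max gam_p gam_m sigma : R).
Variables (beta : nat -> R) (y0 : 'rV[R]_n) (N : nat).
Variables (x y z yh : nat -> 'rV[R]_n) (lam : nat -> R).
Hypotheses (L_gt0 : 0 < L)
  (descent : forall u v, (bregman f u v <= L%:E * bregman half_sqnorm u v)%E)
  (lam0_gt0 : 0 < lam0) (lam0_le_max : lam0 <= lam_max)
  (gam_p_ge1 : 1 <= gam_p) (gam_m_gt1 : 1 < gam_m) (sigma01 : 0 < sigma < 1)
  (run : ga_bpgnc_run f half_sqnorm rho phi lam0 lam_max gam_p gam_m sigma
           beta y0 N x y z yh lam).

Let d := delta f rho y yh.
Let e k := F (y k.-1) - F (yh k).
Let g k := enorm (egrad f (x k)) ^+ 2.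
Let tau k := 2 * fine (d k) / (lam k * g k).
Let lam_low := Num.min lam0 (1 / (gam_m * L)).

Lemma lam_low_gt0 : 0 < lam_low.
Proof.
by rewrite lt_min lam0_gt0 divr_gt0// mulr_gt0// (lt_trans ltr01).
Qed.

(** The initial trial step of each iteration is at least [lam_low], since
    [gam_p >= 1] and [lam_max >= lam0]; backtracking preserves this bound. *)
Lemma run_accepted k : (1 <= k <= N)%N ->
  [/\ lam_low <= lam k, bpg_map f half_sqnorm rho (lam k) (x k) (yh k),
      yh k != x k &
      (bregman f (yh k) (x k)
       <= ((lam k)^-1)%:E * bregman half_sqnorm (yh k) (x k))%E].
Proof.
elim: k => // k IH kN.
apply: (backtrack_accepted descent gam_m_gt1 L_gt0 lam_low_gt0 _ _ (run_step run kN)).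
  by rewrite ge_min lexx orbT.
rewrite /step_init; case: k IH kN => [|k] IH kN /=; first by rewrite ge_min lexx.
have [lamk _ _ _] := IH (ltnW kN).
rewrite le_min (_ : lam_low <= lam_max) ?andbT; last first.
  by apply: le_trans lam0_le_max; rewrite ge_min lexx.
by apply: (le_trans lamk); rewrite ler_peMl// ltW// (lt_le_trans lam_low_gt0).
Qed.

Lemma run_lam_gt0 k : (1 <= k <= N)%N -> 0 < lam k.
Proof. by move=> /run_accepted[/(lt_le_trans lam_low_gt0)]. Qed.

Lemma run_grad_gt0 k : (1 <= k <= N)%N -> 0 < g k.
Proof.
move=> kN; have [_ ymap yx _] := run_accepted kN.
exact: egrad_sqnorm_gt0 (run_lam_gt0 kN) ymap yx.
Qed.

Lemma deltaE k : d k = (e k)%:E.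
Proof. by rewrite /d /delta /Phi /rho !adde0. Qed.

Lemma tau_lamE k : (1 <= k <= N)%N -> tau k * lam k = 2 * e k / g k.
Proof.
move=> kN; rewrite /tau deltaE /=.
have := run_lam_gt0 kN; have := run_grad_gt0 kN.
by move=> g0 l0; field; rewrite !gt_eqF.
Qed.

(** The weight [tau k * lam k] restricted to the successful iterations, so that
   sums over them become sums over all iterations. *)
Let t k := if (0 < d k)%E then tau k * lam k else 0.

Lemma weight_ge0 k : (1 <= k <= N)%N -> 0 <= t k.
Proof.
move=> kN; rewrite /t tau_lamE// deltaE lte_fin; case: ifP => // e0.
by apply: divr_ge0; [rewrite mulr_ge0// ltW | exact/ltW/run_grad_gt0].
Qed.

Lemma weight_ge k : (1 <= k <= N)%N ->
  sigma * lam k / 2 * g k <= e k -> sigma * lam_low <= t k.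
Proof.
move=> kN; have [lamk _ _ _] := run_accepted kN.
have g0 := run_grad_gt0 kN; have l0 := run_lam_gt0 kN.
have /andP[s0 _] := sigma01 => ek.
have e0 : 0 < e k.
  apply: lt_le_trans ek; apply: mulr_gt0 => //.
  by rewrite divr_gt0// mulr_gt0.
rewrite /t deltaE lte_fin e0 tau_lamE//.
apply: (@le_trans _ _ (sigma * lam k)); first by rewrite ler_pM2l.
by rewrite ler_pdivlMr//; lra.
Qed.

(** Extrapolation at iteration [k] requires a decrease proportional to the
    residual at [k]. Without it, [x k.+1 = y k], so the decrease of the gradient
    step [k.+1] is measured from the current best value, with constant
    [1 >= sigma]. *)
Lemma weight_pair k : (1 <= k < N)%N -> sigma * lam_low <= t k + t k.+1.
Proof.
move=> /andP[k1 kN].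
have kR : (1 <= k <= N)%N by rewrite k1 ltnW.
have [_ ymap _ _] := run_accepted kR; have lk0 := run_lam_gt0 kR.
have xE : x k.+1 = z k by rewrite (run_x run).
move: xE; rewrite (run_z run kR); case: asboolP => [[ext _ _ _] _|_ xE].
  apply: (@le_trans _ _ (t k)); last by rewrite lerDl weight_ge0.
  apply: weight_ge => //; move: ext; rewrite bpg_res_smooth//.
  by rewrite -EFinM /Phi /rho !adde0 -EFinB lee_fin.
apply: (@le_trans _ _ (t k.+1)); last by rewrite lerDr weight_ge0.
have kR' : (1 <= k.+1 <= N)%N by [].
apply: weight_ge => //; have [_ ymap' _ acc] := run_accepted kR'.
have lk0' := run_lam_gt0 kR'.
have := accepted_step_decrease lk0' ymap' acc.
rewrite {2}xE -/(e k.+1); apply: le_trans.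
rewrite -/(g _) ler_pM2r ?run_grad_gt0//.
rewrite ler_pM2r// ler_piMl ?ltW//.
by case/andP: sigma01.
Qed.

(** [y k] moves to [yh k] exactly when the decrease is positive, so the
    decreases of the successful iterations are those of [F (y k)]. *)
Lemma decrease_telescope :
  \sum_(1 <= k < N.+1) (if (0 < d k)%E then e k else 0) = F y0 - F (y N).
Proof.
transitivity (\sum_(0 <= k < N) (- F (y k.+1) - - F (y k))).
  rewrite big_add1; apply: eq_big_nat => k kN.
  rewrite opprK (run_y run)// -/(d _) addrC; case: ifP => // _.
  by rewrite subrr.
by rewrite telescope_sumr// (run_y0 run) opprK addrC.
Qed.

Lemma run_rate : (2 <= N)%N -> (-oo < Phi_star f half_sqnorm rho)%E ->
  let A := [seq k <- iota 1 N | (0 < d k)%E] in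
  let gap := fine (Phi f rho y0 - Phi_star f half_sqnorm rho)%E in
  (\big[Order.min/+oo%E]_(k <- A) (g k)%:E
     <= (2 * gap / \sum_(k <- A) tau k * lam k)%:E)%E /\
  2 * gap / \sum_(k <- A) tau k * lam k
    <= 4 * gap / (sigma * lam_low * (N%:R - 1)).
Proof.
move=> N2 star_gt A gap.
have star_le u : (Phi_star f half_sqnorm rho <= (F u)%:E)%E.
  apply: ereal_inf_lbound; exists u; last by rewrite /Phi /rho adde0.
  by rewrite Omega_half_sqnorm closureT.
have {star_le} gap_ge u : F y0 - F u <= gap.
  have := star_le u; rewrite /gap; move: star_gt.
  case: (Phi_star _ _ _) => // s _; rewrite /Phi /rho adde0 -EFinB /= lee_fin.
  by lra.
have iotaE : iota 1 N = index_iota 1 N.+1 by rewrite /index_iota subn1.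
have memA k : k \in A -> (1 <= k <= N)%N.
  by rewrite mem_filter mem_iota add1n ltnS => /andP[].
have /andP[s0 _] := sigma01.
have N1 : 0 < N%:R - 1 :> R by rewrite subr_gt0 ltr1n.
have [] // := @ratio_bounds R A g (fun k => tau k * lam k) (2 * gap)
  (sigma * lam_low * (N%:R - 1) / 2).
- move=> k kA; have := weight_ge0 (memA k kA); rewrite /t.
  by move: kA; rewrite mem_filter => /andP[->].
- by rewrite divr_gt0// !mulr_gt0// lam_low_gt0.
- rewrite ler_pdivrMr// mulrC /A big_filter iotaE big_mkcond /=.
  by rewrite mulrC [leRHS]mulrC; apply: sum_ge_of_pairs;
    [exact: weight_ge0 | exact: weight_pair | exact: ltnW].
- apply: le_trans (_ : 2 * (F y0 - F (y N)) <= _); last by rewrite ler_pM2l.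
  rewrite -decrease_telescope mulr_sumr /A big_filter iotaE big_mkcond /=.
  rewrite big_nat [leRHS]big_nat; apply: ler_sum => k kN.
  case: ifP => _; last by rewrite mulr0.
  by rewrite tau_lamE// divfK// gt_eqF// run_grad_gt0.
- by rewrite mulr_ge0//; have := gap_ge y0; rewrite subrr.
move=> le1 le2; split=> //; apply: (le_trans le2).
have := lam_low_gt0 => c0.
by rewrite le_eqVlt; apply/orP; left; apply/eqP; field; rewrite !gt_eqF.
Qed.

End Run.
End SmoothRun.

(** * Residual bound and convergence rate *)

Theorem mainTheorem6 (R : realType) (n : nat)
    (f psi rho : 'rV[R]_n -> \bar R) (L : R)
    (psi_legendre : legendre psi)
    (f_proper : proper_fun f) (f_lsc : lower_semicontinuous f)
    (dom_psi_f : edom psi `<=` edom f) (f_C1 : C1_on f (Omega psi))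
    (rho_proper : proper_fun rho) (rho_lsc : lower_semicontinuous rho)
    (rho_convex : convex_efun rho)
    (Omega_rho : (Omega psi `&` edom rho) !=set0)
    (L_gt0 : 0 < L)
    (descent : forall u v, Omega psi u -> Omega psi v ->
       (bregman f u v <= L%:E * bregman psi u v)%E)
    (Phi_bounded : (-oo < Phi_star f psi rho)%E)
    (solvable : forall (x : 'rV[R]_n) (lam : R), Omega psi x -> 0 < lam ->
       bpg_map f psi rho lam x !=set0)
    (psi_sqnorm : psi = (fun x => (enorm x ^+ 2 / 2)%:E))
    (Omega_full : Omega psi = [set: 'rV[R]_n]) :
  (forall (lam : R) (x y : 'rV[R]_n), 0 < lam -> edom rho x ->
     bpg_map f psi rho lam x y ->
     ((enorm (lam^-1 *: (x - y)) ^+ 2)%:E <= bpg_res f psi rho lam x y)%E) /\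
  (rho = (fun=> 0%E) ->
     (forall (lam : R) (x y : 'rV[R]_n), 0 < lam ->
        bpg_map f psi rho lam x y ->
        bpg_res f psi rho lam x y = (enorm (egrad f x) ^+ 2)%:E) /\
     (forall (phi : 'rV[R]_n -> \bar R) (lam0 lam_max gam_p gam_m sigma : R)
        (beta : nat -> R) (y0 : 'rV[R]_n) (N : nat)
        (x y z yh : nat -> 'rV[R]_n) (lam : nat -> R),
        legendre phi ->
        (Omega psi `&` edom rho) y0 ->
        0 < lam0 -> lam0 <= lam_max ->
        1 <= gam_p -> 1 < gam_m -> 0 < sigma < 1 ->
        (forall j, 0 <= beta j) ->
        (2 <= N)%N ->
        ga_bpgnc_run f psi rho phi lam0 lam_max gam_p gam_m sigma
          beta y0 N x y z yh lam ->
        let d := delta f rho y yh in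
        let A := [seq k <- iota 1 N | (0 < d k)%E] in
        let tau k := 2 * fine (d k) / (lam k * enorm (egrad f (x k)) ^+ 2) in
        let lam_low := Num.min lam0 (1 / (gam_m * L)) in
        let gap := fine (Phi f rho y0 - Phi_star f psi rho)%E in
        (* the minimum over A is +oo if A is empty *)
        (\big[Order.min/+oo%E]_(k <- A) (enorm (egrad f (x k)) ^+ 2)%:E
           <= (2 * gap / \sum_(k <- A) tau k * lam k)%:E)%E /\
        2 * gap / \sum_(k <- A) tau k * lam k
          <= 4 * gap / (sigma * lam_low * (N%:R - 1)))).
Proof.
have {psi_sqnorm} psiE : psi = half_sqnorm by rewrite psi_sqnorm.
subst psi; split=> [lam x y lam0 rhox|rho0].
  by apply: bpg_res_half_sqnorm_ge => //; case: rho_proper.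
subst rho; split=> [lam x y|]; first exact: bpg_res_smooth.
move=> phi lam0 lam_max gam_p gam_m sigma beta y0 N x y z yh lam _ _.
move=> lam0_gt0 lam0_max gam_p1 gam_m1 sigma01 _ N2 run.
have [F fE] : exists F, f = fun u => (F u)%:E.
  exists (fine \o f); apply/funext => u /=; rewrite fineK// fin_numElt.
  have [fninf _] := f_proper; rewrite ltNye fninf /=.
  by apply: dom_psi_f; rewrite /edom /= ltry.
subst f.
apply: (run_rate L_gt0 _ lam0_gt0 lam0_max gam_p1 gam_m1 sigma01 run) => //.
by move=> u v; apply: descent; rewrite Omega_full.
Qed.
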